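(* Let $X$ be a contact vector field on a contact manifold $(M,\xi)$ of dimension $2n+1$, with (local) contact form $\eta$, and let $x_0$ be an equilibrium point of $X$ with principal coefficient $\tau$. Let $L$ be the linear part of $X$ at $x_0$. Then one of the eigenvalues of $L$ is equal to $\tau$, while the others arise in quadruplets of the form $$\left\{\tfrac12\tau\pm\lambda,\ \tfrac12\tau\pm\bar\lambda\right\}.$$ The eigenvalue $\tau$ corresponds to the eigen-covector $\eta_{x_0}$ (that is, $\eta_{x_0}\circ L=\tau\,\eta_{x_0}$), while the other $2n$ eigenvalues are those of the restriction $L_\xi$ of $L$ to the invariant subspace $\xi(x_0)$.
   Context: All objects are smooth. A contact manifold $(M,\xi)$ is a manifold $M$ of dimension $2n+1$ with a rank-$2n$ subbundle $\xi\subset TM$ such that, for any (local) 1-form $\eta$ with $\ker\eta=\xi$ (a contact form), $\eta\wedge(\mathrm{d}\eta)^n$ is nowhere zero. The Reeb vector field $\mathcal{R}$ is determined by $\iota_{\mathcal{R}}\eta=1$, $\iota_{\mathcal{R}}\mathrm{d}\eta=0$. A contact vector field $X$ is one whose flow preserves $\xi$; its Hamiltonian is $H=-\eta(X)$. At an equilibrium $x_0$ (zero of $X$) the principal coefficient is $\tau=-\mathcal{R}(H)(x_0)$. Eigenvalues are complex and counted with algebraic multiplicity. The elements of a quadruplet are not necessarily all distinct; ''arise in quadruplets'' is meant as for eigenvalues of infinitesimally symplectic matrices: if $\frac12\tau+\lambda$ ($\lambda\in\mathbb{C}$) is an eigenvalue of $L_\xi$ then so are $\frac12\tau-\lambda$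 and $\frac12\tau\pm\bar\lambda$, with the same multiplicity. *)

(* Defs.v *)
From HB Require Import structures.
From mathcomp Require Import all_boot all_order all_algebra all_fingroup.
From mathcomp Require Import all_classical all_reals all_analysis.
From mathcomp Require Import complex.
Import Order.TTheory GRing.Theory Num.Theory.
Import numFieldNormedType.Exports.

Set Implicit Arguments.
Unset Strict Implicit.
Unset Printing Implicit Defensive.

Local Open Scope classical_set_scope.
Local Open Scope ring_scope.
Local Open Scope complex_scope.

(* [f] is of class C^k on the open set [U]: for [k.+1], [f] is Frechet
   differentiable on [U] and all its directional derivatives are of class C^k. *)
Fixpoint Ck (R : realType) (V W : normedModType R) (k : nat) (U : set V)
    (f : V -> W) : Prop :=
  match k with
  | 0 => forall x, U x -> {for x, continuous f}
  | k'.+1 => (forall x, U x -> differentiable f x) /\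
             forall v : V, Ck k' U ('D_v f)
  end.

Definition smooth (R : realType) (V W : normedModType R) (U : set V)
    (f : V -> W) : Prop := forall k, Ck k U f.

(* [cinv] is total but only meaningful on the open set [cmap @` cdom]. *)
Record chart (R : realType) (N : nat) (M : topologicalType) := Chart {
  cdom : set M;
  cmap :> M -> 'rV[R]_N;
  cinv : 'rV[R]_N -> M;
  cdom_open : open cdom;
  cimg_open : open (cmap @` cdom);
  cmapK : forall p, cdom p -> cinv (cmap p) = p;
  cmap_continuous : forall p, cdom p -> {for p, continuous cmap};
  cinv_continuous :
    forall y, (cmap @` cdom) y -> {for y, continuous cinv} }.

(* Smooth N-dimensional manifolds without boundary.  As part of the data, a
   chart [chart_at p] of the atlas is selected around each point [p]; it
   identifies the tangent space at [p] with 'rV[R]_N.  Hence a vector field is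
   a function M -> 'rV[R]_N, a 1-form is a function M -> 'cV[R]_N (paired by
   [v *m eta p]), a field of tangent subspaces is a function M -> 'M[R]_N
   (the subspace at [p] being the row space), and an endomorphism of a tangent
   space is a matrix acting on row vectors from the right. *)
Record manifold (R : realType) (N : nat) := Manifold {
  point :> topologicalType;
  atlas : set (chart R N point);
  chart_at : point -> chart R N point;
  point_hausdorff : hausdorff_space point;
  point_second_countable : @second_countable point;
  atlas_compat : forall c c', atlas c -> atlas c' ->
    smooth (c @` (cdom c `&` cdom c')) (c' \o cinv c);
  chart_at_atlas : forall p, atlas (chart_at p);
  chart_at_dom : forall p, cdom (chart_at p) p }.

(* A k-form on R^N takes its k vector arguments as the rows of a matrix. *)
Definition form (R : realType) (N k : nat) := 'M[R]_(k, N) -> R.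

Definition wedge (R : realType) (N k l : nat) (a : form R N k)
    (b : form R N l) : form R N (k + l) := fun A =>
  ((k`! * l`!)%N%:R)^-1 *
  \sum_(s : 'S_(k + l))
     (-1) ^+ s * a (usubmx (row_perm s A)) * b (dsubmx (row_perm s A)).

Fixpoint wedge_pow (R : realType) (N : nat) (w : form R N 2) (k : nat) :
    form R N (k * 2) :=
  match k return form R N (k * 2) with
  | 0 => fun=> 1
  | k'.+1 => wedge w (@wedge_pow R N w k')
  end.
Arguments wedge_pow {R N} w k _.

Section Tensors.
Context (R : realType) (N : nat) (M : manifold R N).

(* Jacobian at [p] of the change of coordinates from [chart_at p] to [c], and
   of the inverse change. *)
Definition to_chart (c : chart R N M) (p : M) : 'M[R]_N :=
  'J (c \o cinv (chart_at p)) (chart_at p p).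

Definition of_chart (c : chart R N M) (p : M) : 'M[R]_N :=
  'J (chart_at p \o cinv c) (c p).

Definition vf_in_chart (c : chart R N M) (X : M -> 'rV[R]_N) :
    'rV[R]_N -> 'rV[R]_N :=
  fun y => X (cinv c y) *m to_chart c (cinv c y).

Definition oneform_in_chart (c : chart R N M) (eta : M -> 'cV[R]_N) :
    'rV[R]_N -> 'cV[R]_N :=
  fun y => of_chart c (cinv c y) *m eta (cinv c y).

Definition smooth_vector_field (U : set M) (X : M -> 'rV[R]_N) : Prop :=
  forall c, atlas c -> smooth (c @` (U `&` cdom c)) (vf_in_chart c X).

Definition smooth_oneform (U : set M) (eta : M -> 'cV[R]_N) : Prop :=
  forall c, atlas c -> smooth (c @` (U `&` cdom c)) (oneform_in_chart c eta).

(* A field of tangent subspaces is a smooth subbundle of rank [r] when it has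
   local frames. *)
Definition smooth_subbundle (r : nat) (xi : M -> 'M[R]_N) : Prop :=
  (forall p, \rank (xi p) = r) /\
  forall p, exists (U : set M) (e : 'I_r -> M -> 'rV[R]_N),
    [/\ open U, U p, forall i, smooth_vector_field U (e i) &
        forall q, U q -> ((\matrix_i e i q) == xi q)%MS].

Definition oneform_at (eta : M -> 'cV[R]_N) (p : M) : form R N 1 :=
  fun v => (v *m eta p) 0 0.

(* d eta (u, v) = u (eta v) - v (eta u) for [u] and [v] constant in the chart
   [chart_at p]. *)
Definition ext_der_at (eta : M -> 'cV[R]_N) (p : M) : form R N 2 :=
  fun A : 'M[R]_(1 + 1, N) =>
    let u := usubmx A in
    let v := dsubmx A in
    let eta_c := oneform_in_chart (chart_at p) eta in
    (v *m 'D_u eta_c (chart_at p p)) 0 0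
    - (u *m 'D_v eta_c (chart_at p p)) 0 0.

(* Local flows (t, q) |-> Phi t q, defined for [`|t| < e] and [q] in [U].
   The velocity of a curve at a point is read in the chart selected there. *)
Definition local_flow (X : M -> 'rV[R]_N) (U : set M) (e : R)
    (Phi : R -> M -> M) : Prop :=
  [/\ (forall q, U q -> Phi 0 q = q),
      (forall t q, `|t| < e -> U q ->
         {for (t, q), continuous (fun z : R * M => Phi z.1 z.2)}),
      (forall c c', atlas c -> atlas c' ->
         smooth [set z : R^o * 'rV[R]_N | [/\ `|z.1| < e,
                   (c @` (U `&` cdom c)) z.2 &
                   cdom c' (Phi z.1 (cinv c z.2))]]
                (fun z => c' (Phi z.1 (cinv c z.2)))) &
      (forall t q, `|t| < e -> U q ->
         is_derive (t : R^o) 1 (fun s : R^o => chart_at (Phi t q) (Phi s q))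
                   (X (Phi t q)))].

(* Tangent map of [f] at [p], from the tangent space at [p] to the one at
   [f p]. *)
Definition tangent_map (f : M -> M) (p : M) : 'M[R]_N :=
  'J (chart_at (f p) \o f \o cinv (chart_at p)) (chart_at p p).

Definition flow_preserves (xi : M -> 'M[R]_N) (U : set M) (e : R)
    (Phi : R -> M -> M) : Prop :=
  forall t q, `|t| < e -> U q ->
    (xi q *m tangent_map (Phi t) q == xi (Phi t q))%MS.

(* Linear part at an equilibrium. *)
Definition linear_part (X : M -> 'rV[R]_N) (x0 : M) : 'M[R]_N :=
  'J (vf_in_chart (chart_at x0) X) (chart_at x0 x0).

(* Derivative at [p] of a function along a tangent vector at [p]. *)
Definition dir_der (v : 'rV[R]_N) (H : M -> R) (p : M) : R :=
  'D_v (H \o cinv (chart_at p) : 'rV[R]_N -> R^o) (chart_at p p).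

Definition hamiltonian (eta : M -> 'cV[R]_N) (X : M -> 'rV[R]_N) (p : M) : R :=
  - (X p *m eta p) 0 0.

Definition is_reeb (W : set M) (eta : M -> 'cV[R]_N) (Rb : M -> 'rV[R]_N) :
    Prop :=
  forall q, W q -> (Rb q *m eta q) 0 0 = 1 /\
    forall v : 'rV[R]_N, ext_der_at eta q (col_mx (Rb q) v) = 0.

Definition principal_coefficient (eta : M -> 'cV[R]_N) (Rb X : M -> 'rV[R]_N)
    (x0 : M) : R := - dir_der (Rb x0) (hamiltonian eta X) x0.

End Tensors.

Section Contact.
Context (R : realType) (n : nat) (M : manifold R (n * 2).+1).

(* Smooth 1-forms on the open set [W] whose kernel is [xi]. *)
Definition local_form (xi : M -> 'M[R]_((n * 2).+1)) (W : set M)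
    (eta : M -> 'cV[R]_((n * 2).+1)) : Prop :=
  [/\ open W, smooth_oneform W eta &
      forall p, W p -> (kermx (eta p) == xi p)%MS].

Definition contact_structure (xi : M -> 'M[R]_((n * 2).+1)) : Prop :=
  smooth_subbundle (n * 2) xi /\
  forall W eta, local_form xi W eta -> forall p, W p ->
    exists A : 'M[R]_(1 + n * 2, (n * 2).+1),
      wedge (oneform_at eta p) (wedge_pow (ext_der_at eta p) n) A != 0.

(* Local flows of a smooth vector field exist and any two of them agree for
   small times, so asking one of them around each point to preserve [xi] is the
   same as asking it of all of them. *)
Definition contact_vector_field (xi : M -> 'M[R]_((n * 2).+1))
    (X : M -> 'rV[R]_((n * 2).+1)) : Prop :=
  smooth_vector_field setT X /\
  forall p, exists (U : set M) (e : R) (Phi : R -> M -> M),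
    [/\ open U, U p, 0 < e, local_flow X U e Phi & flow_preserves xi U e Phi].

End Contact.

(* [s] lists the complex eigenvalues of the real matrix [A], repeated according
   to their algebraic multiplicities. *)
Definition is_spectrum (R : realType) (m : nat) (A : 'M[R]_m) (s : seq R[i]) :
    Prop :=
  char_poly (map_mx (real_complex R) A) = \prod_(z <- s) ('X - z%:P).

(* Main.v *)
(* In the chart at the equilibrium, preservation of xi by the flow says that
   v J_t eta(phi_t y) = 0 whenever v eta(y) = 0, where J_t is the Jacobian of
   phi_t at y acting on row vectors.  Differentiating at t = 0
   gives (L_X eta)_y = f(y) eta_y for y near x_0.  At x_0 this says that
   eta_{x_0} is a left eigenvector of L, with eigenvalue f(x_0) = tau; since X
   vanishes at x_0, one more exterior derivative gives
   d eta (L u, v) + d eta (u, L v) = tau d eta (u, v) for u, v in xi(x_0).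
   The contact condition makes d eta nondegenerate on xi(x_0), so L_xi is
   similar to tau - L_xi^T; being real, it has its spectrum invariant under
   both z |-> tau - z and complex conjugation. *)
Require Import Defs.
From HB Require Import structures.
From mathcomp Require Import all_boot all_order all_algebra all_fingroup.
From mathcomp Require Import all_classical all_reals all_analysis.
From mathcomp Require Import complex ring.
Import Order.TTheory GRing.Theory Num.Theory.
Import numFieldNormedType.Exports.

Set Implicit Arguments.
Unset Strict Implicit.
Unset Printing Implicit Defensive.

Local Open Scope classical_set_scope.
Local Open Scope ring_scope.
Local Open Scope complex_scope.

(** * Characteristic polynomials *)

(** The two sizes are only propositionally equal because one basis used later is built by stacking,
    with [\rank V + 1] rows in a space of dimension [N]. *)
Lemma char_poly_similar (F : fieldType) (p q : nat) (A : 'M[F]_p)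
    (B : 'M[F]_q) (P : 'M[F]_(p, q)) :
  p = q -> row_free P -> A *m P = P *m B -> char_poly A = char_poly B.
Proof.
move=> pq; case: q / pq B P => B P; rewrite row_free_unit => Pu AP.
have Pdet : \det (map_mx polyC P) != 0.
  by rewrite det_map_mx polyC_eq0 -unitfE.
apply: (mulIf Pdet); rewrite -!det_mulmx.
rewrite [RHS](_ : _ = \det (map_mx polyC P *m char_poly_mx B)); last first.
  by rewrite !det_mulmx mulrC.
by rewrite mulmxBl mulmxBr -!map_mxM AP scalar_mxC.
Qed.

Lemma char_poly_trmx (F : fieldType) (p : nat) (A : 'M[F]_p) :
  char_poly A^T = char_poly A.
Proof.
by rewrite /char_poly -det_tr /char_poly_mx linearB /= tr_scalar_mx map_trmx trmxK.
Qed.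

Lemma char_poly_lblock (F : fieldType) (p q : nat) (A : 'M[F]_p)
    (C : 'M[F]_(q, p)) (D : 'M[F]_q) :
  char_poly (block_mx A 0 C D) = char_poly A * char_poly D.
Proof.
rewrite /char_poly /char_poly_mx scalar_mx_block map_block_mx map_mx0.
by rewrite opp_block_mx add_block_mx subr0 det_lblock.
Qed.

(** Append [r] to a basis of the hyperplane [V]. Since [r *m L - tau *: r] is killed by [eta], it
    lies in [V], so in this basis [L] is block lower triangular with diagonal blocks
    [restrictmx V L] and [tau]. *)
Lemma char_poly_restrict_hyperplane (F : fieldType) (N : nat) (L V : 'M[F]_N)
    (eta : 'cV[F]_N) (r : 'rV[F]_N) (tau : F) :
    (kermx eta == V)%MS -> (r *m eta) 0 0 = 1 -> L *m eta = tau *: eta ->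
  char_poly L = ('X - tau%:P) * char_poly (restrictmx V L).
Proof.
move=> /eqmxP kV reta Leta.
have Veta : V *m eta = 0 by apply/sub_kermxP; rewrite kV.
have rE : r *m eta = 1%:M by rewrite [LHS]mx11_scalar reta.
have eta0 : eta != 0.
  apply/eqP => e0; move: reta; rewrite e0 mulmx0 mxE.
  by move=> /esym/eqP; rewrite oner_eq0.
have VL : stablemx V L.
  by rewrite -kV; apply/sub_kermxP; rewrite -mulmxA Leta -scalemxAr Veta scaler0.
set B := row_base V.
have Beta : B *m eta = 0.
  by apply/eqP; rewrite -sub_kermx kV /B eq_row_base.
have BL : restrictmx V L *m B = B *m L.
  by rewrite /conjmx mulmxKpV // stablemx_row_base.
have rkV : (\rank V + 1)%N = N.
  rewrite -kV mxrank_ker; have : \rank eta = 1%N.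
    by apply/eqP; rewrite eqn_leq rank_leq_col lt0n mxrank_eq0.
  move=> e1; rewrite e1 subnK //; have := rank_leq_row eta; by rewrite e1.
have [C CE] : exists C, r *m L - tau *: r = C *m B.
  apply/submxP; rewrite eq_row_base -kV; apply/sub_kermxP.
  by rewrite mulmxBl -mulmxA Leta -scalemxAr -scalemxAl subrr.
pose P := col_mx B r.
have Pfree : row_free P.
  rewrite -kermx_eq0; apply/eqP/row_matrixP => i.
  rewrite row0; set w := row i _.
  have : w *m P = 0 by rewrite /w -row_mul mulmx_ker row0.
  rewrite -[w]hsubmxK mul_row_col => wP.
  have w2 : rsubmx w = 0.
    move: (congr1 (fun z => z *m eta) wP).
    by rewrite mulmxDl -(mulmxA _ B) -(mulmxA _ r) Beta rE mulmx0 add0r mulmx1 mul0mx.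
  move: wP; rewrite w2 mul0mx addr0 => /eqP.
  by rewrite mulmx_free_eq0 ?row_base_free // => /eqP ->; rewrite row_mx0.
rewrite -(@char_poly_similar _ _ _ (block_mx (restrictmx V L) 0 C tau%:M) _ P) //.
  rewrite char_poly_lblock mulrC; congr (_ * _).
  by rewrite /char_poly /char_poly_mx map_scalar_mx -raddfB det_scalar1.
rewrite mul_block_col mul_col_mx BL mul0mx addr0 -CE mul_scalar_mx subrK.
by [].
Qed.

(** Substituting [tau - 'X] into the determinant of ['X - B] gives the determinant of
    [- ('X - (tau - B))]; the sign comes out [m] times. *)
Lemma char_poly_reflect (F : fieldType) (m : nat) (B : 'M[F]_m) (tau : F) :
  char_poly (tau%:M - B) = (-1) ^+ m *: (char_poly B \Po (tau%:P - 'X)).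
Proof.
have compE (A : 'M[{poly F}]_m) :
    \det A \Po (tau%:P - 'X) = \det (map_mx (comp_poly (tau%:P - 'X)) A).
  by rewrite -det_map_mx.
rewrite /char_poly compE -mul_polyC rmorphXn rmorphN1 -detZ.
congr (\det _); apply/matrixP => i j; rewrite !mxE.
rewrite linearB /= raddfMn /= comp_polyC comp_polyX polyCB polyCMn.
by rewrite mulrnBl; ring.
Qed.

(** The relation reads [A *m Om = Om *m (tau%:M - A)^T], a similarity as [Om] is invertible. Root
    lists of equal split polynomials are permutations of each other, which keeps track of
    multiplicities. *)
Lemma conformal_spectrum (R : realType) (m : nat) (A Om : 'M[R]_m) (tau : R) :
    Om \in unitmx -> A *m Om + Om *m A^T = tau *: Om ->
  exists s : seq R[i],
    [/\ size s = m, is_spectrum A s,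
        perm_eq s [seq tau%:C - z | z <- s] & perm_eq s [seq z^* | z <- s]].
Proof.
move=> Omu AOm.
set iota := real_complex R.
have [s sE] := closed_field_poly_normal (char_poly (map_mx iota A)).
rewrite (monicP (char_poly_monic _)) scale1r in sE.
have ssz : size s = m.
  by apply: succn_inj; rewrite -(size_prod_XsubC _ id) -sE size_char_poly.
exists s; split => //.
- have reflA : char_poly A = char_poly (tau%:M - A).
    rewrite -(char_poly_trmx (tau%:M - A)).
    apply: (@char_poly_similar _ _ _ _ _ Om); rewrite ?row_free_unit //.
    rewrite linearB /= tr_scalar_mx mulmxBr scalar_mxC mul_scalar_mx -AOm.
    by rewrite addrK.
  apply: prod_XsubC_eq; rewrite -sE -map_char_poly reflA map_char_poly.
  rewrite map_mxB map_scalar_mx char_poly_reflect sE rmorph_prod /= big_map.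
  (* Each of the [m] roots contributes a factor -1; together they cancel the sign from
     [char_poly_reflect]. *)
  rewrite (eq_bigr (fun z => -1 * ('X - (tau%:C - z)%:P))) => [|z _]; last first.
    by rewrite rmorphB /= comp_polyX comp_polyC polyCB; ring.
  rewrite big_split /= big_const_seq count_predT ssz iter_mulr_1.
  rewrite -mul_polyC rmorphXn rmorphN1 mulrA -exprMn.
  by rewrite mulrNN mulr1 expr1n mul1r.
- apply: prod_XsubC_eq; rewrite big_map -sE.
  have : map_poly conjc (char_poly (map_mx iota A)) = char_poly (map_mx iota A).
    rewrite map_char_poly -map_mx_comp; congr char_poly.
    by apply: eq_map_mx => x /=; exact: conjc_real.
  move=> <-; rewrite {1}sE rmorph_prod; apply: eq_bigr => z _.
  by rewrite rmorphB /= map_polyX map_polyC.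
Qed.

(** * Multilinear forms and the contact condition *)

Definition multilinear_form (R : realType) (N k : nat) (w : Defs.form R N k) :=
  forall (i : 'I_k) (a b : R) (A B C : 'M[R]_(k, N)),
    row i A = a *: row i B + b *: row i C ->
    (forall j, j != i -> row j B = row j A /\ row j C = row j A) ->
  w A = a * w B + b * w C.

(** In each summand the permutation sends row [i] either to the first [k] or to the last [l]
    arguments, so exactly one of the two factors depends on it. *)
Lemma wedge_multilinear (R : realType) (N k l : nat) (w1 : Defs.form R N k)
    (w2 : Defs.form R N l) :
  multilinear_form w1 -> multilinear_form w2 -> multilinear_form (wedge w1 w2).
Proof.
move=> m1 m2 i a b A B C Ai ABC; rewrite /wedge.
rewrite mulrCA [b * _]mulrCA -mulrDr; congr (_ * _).
rewrite !mulr_sumr -big_split /=; apply: eq_bigr => s _.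
rewrite -!mulrA (mulrCA a) (mulrCA b) -mulrDr; congr (_ * _).
have rowu D j : row j (usubmx (row_perm s D)) = row (s (lshift l j)) D.
  by apply/rowP => ?; rewrite !mxE.
have rowd D j : row j (dsubmx (row_perm s D)) = row (s (rshift k j)) D.
  by apply/rowP => ?; rewrite !mxE.
move: (permKV s i); case: (split_ordP (s^-1%g i)) => j -> ij.
- have eqd D : (forall j, j != i -> row j D = row j A) ->
    dsubmx (row_perm s D) = dsubmx (row_perm s A).
    move=> DA; apply/row_matrixP => j'; rewrite !rowd DA // -ij.
    by rewrite (inj_eq perm_inj) eq_rlshift.
  rewrite (eqd B) ?(eqd C) => [|j' /ABC[]|j' /ABC[]] //.
  rewrite (m1 j a b _ (usubmx (row_perm s B)) (usubmx (row_perm s C))).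
  + by rewrite mulrDl !mulrA.
  + by rewrite !rowu ij.
  + move=> j' j'j; rewrite !rowu; apply: ABC.
    by rewrite -ij (inj_eq perm_inj) (inj_eq (@lshift_inj _ _)).
- have eqd D : (forall j, j != i -> row j D = row j A) ->
    usubmx (row_perm s D) = usubmx (row_perm s A).
    move=> DA; apply/row_matrixP => j'; rewrite !rowu DA // -ij.
    by rewrite (inj_eq perm_inj) eq_lrshift.
  rewrite (eqd B) ?(eqd C) => [|j' /ABC[]|j' /ABC[]] //.
  rewrite (m2 j a b _ (dsubmx (row_perm s B)) (dsubmx (row_perm s C))).
  + by rewrite mulrDr !(mulrCA (w1 _)).
  + by rewrite !rowd ij.
  + move=> j' j'j; rewrite !rowd; apply: ABC.
    by rewrite -ij (inj_eq perm_inj) (inj_eq (@rshift_inj _ _)).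
Qed.

Lemma wedge_pow_multilinear (R : realType) (N : nat) (w : Defs.form R N 2) k :
  multilinear_form w -> multilinear_form (wedge_pow w k).
Proof.
move=> mw; elim: k => [|k IHk]; first by case.
exact: (@wedge_multilinear _ _ 2).
Qed.

(** The sum runs over all permutations, so reindexing by right multiplication with [t] gives
    alternation for arbitrary [w1] and [w2]. *)
Lemma wedge_row_perm (R : realType) (N k l : nat) (w1 : Defs.form R N k)
    (w2 : Defs.form R N l) (t : 'S_(k + l)) A :
  wedge w1 w2 (row_perm t A) = (-1) ^+ t * wedge w1 w2 A.
Proof.
rewrite /wedge mulrCA; congr (_ * _); rewrite mulr_sumr.
rewrite [RHS](reindex_inj (mulIg t)); apply: eq_bigr => s _.
rewrite -row_permM odd_permM signr_addb (mulrC _ ((-1) ^+ t)) !mulrA -expr2.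
by rewrite sqrr_sign mul1r.
Qed.

(** Take a relation [c *m A = 0] with [c 0 i] nonzero and put [c *m A] in row [i]. By linearity the
    value is [c 0 i * w A], the other terms having a repeated row; it is also the value at a zero
    row. *)
Lemma multilinear_alternating_eq0 (R : realType) (N k : nat) (w : Defs.form R N k)
    (A : 'M[R]_(k, N)) :
    multilinear_form w ->
    (forall (t : 'S_k) B, w (row_perm t B) = (-1) ^+ t * w B) ->
  ~~ row_free A -> w A = 0.
Proof.
move=> mw aw; rewrite -kermx_eq0 => /rowV0Pn[c /sub_kermxP cA /rV0Pn[i ci]].
pose repl (v : 'rV[R]_N) : 'M[R]_(k, N) :=
  \matrix_j (if j == i then v else row j A).
have repl_row j : w (repl (row j A)) = if j == i then w A else 0.
  case: eqP => [->|/eqP ji].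
    by congr w; apply/row_matrixP => l; rewrite rowK; case: eqP => // ->.
  (* Exchanging the equal rows [i] and [j] fixes the matrix but negates the value. *)
  have := aw (tperm i j) (repl (row j A)).
  rewrite odd_tperm eq_sym ji expr1 mulN1r.
  have -> : row_perm (tperm i j) (repl (row j A)) = repl (row j A).
    apply/row_matrixP => l.
    have -> B : row l (row_perm (tperm i j) B) = row (tperm i j l) B.
      by apply/rowP => ?; rewrite !mxE.
    rewrite !rowK.
    case: tpermP => [->|->|]; rewrite ?eqxx ?(negbTE ji) //.
  by move=> /eqP; rewrite -subr_eq0 opprK -mulr2n mulrn_eq0 /= => /eqP.
have repl_lin a v v' : w (repl (a *: v + v')) = a * w (repl v) + w (repl v').
  rewrite -[w (repl v')]mul1r; apply: (mw i); rewrite ?rowK ?eqxx ?scale1r //.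
  by move=> j ji; rewrite !rowK (negbTE ji).
have repl0 : w (repl 0) = 0.
  by have := repl_lin 1 0 0; rewrite scaler0 addr0 mul1r => /eqP;
    rewrite -subr_eq0 opprD addrA subrr sub0r oppr_eq0 => /eqP.
have : w (repl (c *m A)) = c 0 i * w A.
  rewrite mulmx_sum_row.
  transitivity (\sum_j c 0 j * w (repl (row j A))).
    elim/big_rec2: _ => // j y v _ <-; exact: repl_lin.
  rewrite (bigD1 i) //= repl_row eqxx big1 ?addr0 // => j /negbTE ji.
  by rewrite repl_row ji mulr0.
by rewrite cA repl0 => /esym/eqP; rewrite mulf_eq0 (negbTE ci) /= => /eqP.
Qed.

Lemma wedge_mulmxr (R : realType) (N k l : nat) (w1 : Defs.form R N k)
    (w2 : Defs.form R N l) (P : 'M[R]_N) :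
  (forall A, w1 (A *m P) = w1 A) -> (forall A, w2 (A *m P) = w2 A) ->
  forall A, wedge w1 w2 (A *m P) = wedge w1 w2 A.
Proof.
move=> P1 P2 A; rewrite /wedge; congr (_ * _); apply: eq_bigr => s _.
by rewrite !row_permE mulmxA -!mul_usub_mx -!mul_dsub_mx P1 P2.
Qed.

Lemma wedge_pow_mulmxr (R : realType) (N : nat) (w : Defs.form R N 2) (P : 'M[R]_N) k :
  (forall A, w (A *m P) = w A) ->
  forall A, wedge_pow w k (A *m P) = wedge_pow w k A.
Proof. by move=> Pw; elim: k => //= k IHk A; apply: (@wedge_mulmxr _ _ 2). Qed.

(* A kernel vector [u] lets all arguments be projected along [u] into a
   hyperplane, where any top-degree form vanishes. *)
Lemma wedge_contact_nondegenerate (R : realType) (n : nat)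
    (eta : 'cV[R]_((n * 2).+1)) (Om : 'M[R]_((n * 2).+1))
    (A : 'M[R]_(1 + n * 2, (n * 2).+1))
    (u : 'rV[R]_((n * 2).+1)) :
    wedge (fun v : 'rV[R]_((n * 2).+1) => (v *m eta) 0 0)
      (wedge_pow (fun B : 'M[R]_(1 + 1, (n * 2).+1) =>
         (usubmx B *m Om *m (dsubmx B)^T) 0 0) n) A != 0 ->
    u *m eta = 0 -> u *m Om = 0 -> Om *m u^T = 0 ->
  u = 0.
Proof.
set w1 := fun v => _; set w2 := fun B => _; move=> wA0 ueta uOm Omu.
apply/eqP/negP => /negP /rV0Pn[i ui]; move/eqP: wA0; apply.
(* [q] is a column dual to [u], so [P] below is the projection along [u]; it fixes [eta] and [Om]
   because both vanish on [u]. *)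
pose q : 'cV[R]_((n * 2).+1) := (u 0 i)^-1 *: delta_mx i 0.
have uq : u *m q = 1%:M.
  rewrite -scalemxAr -colE; apply/matrixP => a b; rewrite !ord1 !mxE eqxx.
  by rewrite mulVf.
pose P := 1%:M - q *m u.
have uP : u *m P = 0 by rewrite mulmxBr mulmx1 mulmxA uq mul1mx subrr.
have Peta : P *m eta = eta by rewrite mulmxBl mul1mx -mulmxA ueta mulmx0 subr0.
have POm : P *m Om *m P^T = Om.
  rewrite mulmxBl mul1mx -mulmxA uOm mulmx0 subr0 linearB /= trmx1 trmx_mul.
  by rewrite mulmxBr mulmx1 mulmxA Omu mul0mx subr0.
have P1 B : w1 (B *m P) = w1 B by rewrite /w1 -mulmxA Peta.
have P2 B : w2 (B *m P) = w2 B.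
  rewrite /w2 -[in RHS]POm -mul_usub_mx -mul_dsub_mx trmx_mul.
  by rewrite !mulmxA.
have mw1 : multilinear_form w1.
  move=> j a b B C D; rewrite !ord1 !row_id => -> _.
  by rewrite /w1 mulmxDl -!scalemxAl !mxE.
have mw2 : multilinear_form w2.
  move=> j a b B C D; rewrite /w2.
  have uE E : usubmx E = row (lshift 1 ord0) E by apply/rowP => ?; rewrite !mxE.
  have dE E : dsubmx E = row (rshift 1 ord0) E by apply/rowP => ?; rewrite !mxE.
  rewrite !uE !dE; case: (split_ordP j) => l ->; rewrite ord1 => Bj oB.
  - have [] := oB (rshift 1 0); first by rewrite eq_rlshift.
    by move=> -> ->; rewrite Bj !mulmxDl -!scalemxAl !mxE.
  - have [] := oB (lshift 1 0); first by rewrite eq_lrshift.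
    by move=> -> ->; rewrite Bj linearD /= !linearZ /= mulmxDr -!scalemxAr !mxE.
rewrite -(wedge_mulmxr P1 (wedge_pow_mulmxr P2)).
apply: multilinear_alternating_eq0.
- exact: wedge_multilinear mw1 (wedge_pow_multilinear mw2).
- by move=> t B; apply: wedge_row_perm.
apply/negP => /row_freeP[D AD].
have : \rank (A *m P) = (1 + n * 2)%N.
  apply/eqP; apply/row_freeP; by exists D.
move=> rk; have : (\rank P < (n * 2).+1)%N.
  rewrite ltn_neqAle rank_leq_row andbT; apply/negP => rP.
  have : row_free P := rP; move=> /row_freeP[Q PQ].
  move: ui; suff -> : u = 0 by rewrite mxE eqxx.
  by rewrite -[u]mulmx1 -PQ mulmxA uP mul0mx.
by move=> /(leq_ltn_trans (mxrankM_maxr A P)); rewrite rk ltnn.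
Qed.

(** * Symmetry of second derivatives *)

Lemma is_derive_line (R : realType) (V W : normedModType R) (f : V -> W)
    (u z : V) (s : R) :
  differentiable f (s *: u + z) ->
  is_derive (s : R^o) (1 : R^o) (fun t : R^o => f (t *: u + z)) ('D_u f (s *: u + z)).
Proof.
move=> df.
have E : (fun h : R => h^-1 *:
     (((fun t : R^o => f (t *: u + z)) \o shift (s : R^o)) (h *: (1 : R^o))
      - f (s *: u + z)))
   = (fun h : R => h^-1 *: ((f \o shift (s *: u + z)) (h *: u) - f (s *: u + z))).
  by apply/funext => h /=; rewrite [h *: 1]mulr1 scalerDl addrA.
split; last by rewrite /derive E.
by rewrite /derivable E; exact: diff_derivable.
Qed.

Lemma differentiable_near_linear (R : realType) (V W : normedModType R)
    (g : V -> W) (x : V) (e : R) : differentiable g x -> 0 < e ->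
  \forall k \near 0, `|g (k + x) - g x - 'd g x k| <= e * `|k|.
Proof.
move=> /diff_locallyP[_ /eqaddoP/(_ e)] H e0; have := H e0.
by apply: filterS => k /=; rewrite !fctE /= opprD addrA.
Qed.

(** The mean value theorem in direction [u] turns the second difference into [h] times the increment
    of [g] from [c *: u + x] to [c *: u + (h *: v + x)]. Expanding [g] to first order at [x], the
    [c *: u] parts cancel and [h * 'd g x v] remains. *)
Lemma second_difference_cvg (R : realType) (V : normedModType R) (f g : V -> R^o)
    (x u v : V) :
    (\forall z \near x, differentiable f z /\ 'D_u f z = g z) ->
    differentiable g x ->
  (fun h : R => (h ^- 2 *
      (f (h *: u + (h *: v + x)) - f (h *: v + x) - (f (h *: u + x) - f x)) : R^o))
    @ 0^'+ --> ('D_v g x : R^o).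
Proof.
move=> fg dg; apply/cvgrPdist_le => /= e e0.
have [/= d1 d10 fgd] := (nbhs_ballP _ _).1 fg.
(* [h * K] strictly bounds every displacement from [x] below; the added 1 keeps [K] positive when
   [u] and [v] are zero. *)
set K := `|u| + `|v| + 1.
have K0 : 0 < K by rewrite ltr_wpDl // addr_ge0.
(* Two expansions of [g] are compared, so each may contribute an error of at most half of
   [e * h]. *)
pose e' := e / (2 * K).
have e'0 : 0 < e' by rewrite divr_gt0 // mulr_gt0.
have [/= d2 d20 gd] := (nbhs_ballP _ _).1 (differentiable_near_linear dg e'0).
near=> h.
have h0 : 0 < h by near: h; exact: nbhs_right_gt.
have hd1 : h * K < d1.
  by rewrite -ltr_pdivlMr //; near: h; apply: nbhs_right_lt; rewrite divr_gt0.
have hd2 : h * K < d2.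
  by rewrite -ltr_pdivlMr //; near: h; apply: nbhs_right_lt; rewrite divr_gt0.
have small (s r : R) : 0 <= s <= h -> 0 <= r <= h ->
    `|s *: u + r *: v| <= h * (`|u| + `|v|).
  move=> /andP[s0 sh] /andP[r0 rh]; apply: (le_trans (ler_normD _ _)).
  by rewrite mulrDr !normrZ !ger0_norm // lerD // ler_wpM2r.
have smallK : h * (`|u| + `|v|) < h * K by rewrite ltr_pM2l // ltrDl.
have fd (s r : R) : 0 <= s <= h -> 0 <= r <= h ->
    differentiable f (s *: u + (r *: v + x)) /\
    'D_u f (s *: u + (r *: v + x)) = g (s *: u + (r *: v + x)).
  move=> sh rh; apply: fgd; rewrite -ball_normE /= addrA opprD addrCA subrr.
  rewrite addr0 normrN.
  exact: le_lt_trans (small _ _ sh rh) (lt_trans smallK hd1).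
have gl (s r : R) : 0 <= s <= h -> 0 <= r <= h ->
    `|g (s *: u + (r *: v + x)) - g x - 'd g x (s *: u + r *: v)|
      <= e' * (h * (`|u| + `|v|)).
  move=> sh rh; rewrite addrA; apply: le_trans (gd _ _) _.
    rewrite -ball_normE /= sub0r normrN.
    exact: le_lt_trans (small _ _ sh rh) (lt_trans smallK hd2).
  by rewrite ler_pM2l // small.
have hh : 0 <= h <= h by rewrite lexx ltW.
have h00 : 0 <= (0 : R) <= h by rewrite lexx ltW.
pose phi (s : R^o) : R^o := f (s *: u + (h *: v + x)) - f (s *: u + x).
have dphi s : 0 <= s <= h -> is_derive (s : R^o) (1 : R^o) phi
    (g (s *: u + (h *: v + x)) - g (s *: u + x)).
  move=> sh; have [d1' <-] := fd s h sh hh.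
  have [d2' E2] := fd s 0 sh h00; rewrite scale0r add0r in d2' E2.
  by rewrite -E2; apply: is_deriveB; apply: is_derive_line.
have [||c ch phiE] := @MVT R phi
  (fun s => g (s *: u + (h *: v + x)) - g (s *: u + x)) 0 h h0.
- move=> s; rewrite in_itv /= => /andP[s0 sh]; apply: dphi; by rewrite !ltW.
- apply: derivable_within_continuous => s; rewrite in_itv /= => sh.
  by have [] := dphi s sh.
have {}ch : 0 <= c <= h by move: ch; rewrite in_itv /= => /andP[? ?]; rewrite !ltW.
have -> : f (h *: u + (h *: v + x)) - f (h *: v + x) - (f (h *: u + x) - f x)
   = h * (g (c *: u + (h *: v + x)) - g (c *: u + x)).
  move: phiE; rewrite /phi !scale0r !add0r subr0 mulrC => <-.
  by ring.
rewrite deriveE // expr2 invfM mulrA mulfVK ?gt_eqF //.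
have := gl c h ch hh; have := gl c 0 ch h00.
have dgl r : 'd g x (c *: u + r *: v) = c * 'd g x u + r * 'd g x v.
  by rewrite linearD !linearZ.
rewrite !dgl scale0r add0r mul0r addr0.
set p := g (c *: u + (h *: v + x)); set q := g (c *: u + x).
set a := 'd g x u; set b := 'd g x v => H1 H2.
have e'K : e' * (`|u| + `|v|) <= e / 2.
  rewrite (_ : e / 2 = e' * K); last by rewrite /e'; field; rewrite gt_eqF.
  by rewrite ler_pM2l // lerDl.
have -> : b - h^-1 * (p - q) =
    h^-1 * ((q - g x - c * a) - (p - g x - (c * a + h * b))).
  by field; rewrite gt_eqF.
rewrite normrM gtr0_norm ?invr_gt0 // ler_pdivrMl //.
apply: le_trans (ler_normB _ _) _; apply: le_trans (lerD H1 H2) _.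
rewrite mulrCA -mulrDr ler_pM2l // [leRHS]splitr.
exact: lerD.
Unshelve. all: by end_near.
Qed.

(** The second difference quotient is symmetric in [u] and [v], and both iterated derivatives are
    its limit. *)
Lemma derive_comm (R : realType) (V : normedModType R) (f gu gv : V -> R^o)
    (x u v : V) :
    (\forall z \near x,
       [/\ differentiable f z, 'D_u f z = gu z & 'D_v f z = gv z]) ->
    differentiable gu x -> differentiable gv x ->
  'D_v gu x = 'D_u gv x.
Proof.
move=> fg dgu dgv.
have := @second_difference_cvg _ _ f gu x u v _ dgu.
have := @second_difference_cvg _ _ f gv x v u _ dgv.
have fgu : \forall z \near x, differentiable f z /\ 'D_u f z = gu z.
  by apply: filterS fg => z [].
have fgv : \forall z \near x, differentiable f z /\ 'D_v f z = gv z.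
  by apply: filterS fg => z [].
move=> /(_ fgv) Cv /(_ fgu) Cu.
apply: (@cvg_unique _ (@Rhausdorff R) _ _ _ _ Cu).
apply: cvg_trans Cv; apply: near_eq_cvg; near=> h.
by rewrite /= addrCA; congr (_ * _); ring.
Unshelve. all: by end_near.
Qed.

(** * Matrix-valued maps and partial derivatives *)

Lemma derive_coord (R : realType) (V : normedModType R) m n
    (f : V -> 'M[R]_(m, n)) z u i j :
  differentiable f z -> ('D_u f z) i j = 'D_u (fun y => f y i j : R^o) z.
Proof. by move=> df; rewrite derive_mx ?mxE //; exact: diff_derivable. Qed.

Lemma differentiable_entry (R : realType) (V : normedModType R) m n
    (f : V -> 'M[R]_(m, n)) z i j :
  differentiable f z -> differentiable (fun y => f y i j : R^o) z.
Proof.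
move=> df; apply: (@differentiable_comp _ _ _ _ f
  (fun N : 'M[R]_(m, n) => N i j : R^o)) => //.
exact: differentiable_coord.
Qed.

Lemma derive_comm_mx (R : realType) (V : normedModType R) m n
    (f : V -> 'M[R]_(m, n)) (x u v : V) :
    (\forall z \near x, differentiable f z) ->
    differentiable ('D_u f) x -> differentiable ('D_v f) x ->
  'D_v ('D_u f) x = 'D_u ('D_v f) x.
Proof.
move=> df du dv; apply/matrixP => i j.
have Eu : ('D_v ('D_u f) x) i j = 'D_v (fun y => 'D_u f y i j : R^o) x :=
  derive_coord v i j du.
have Ev : ('D_u ('D_v f) x) i j = 'D_u (fun y => 'D_v f y i j : R^o) x :=
  derive_coord u i j dv.
apply: etrans Eu _; apply: etrans _ (esym Ev).
apply: (@derive_comm _ _ (fun y => f y i j)).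
- apply: filterS df => z dz; split; first exact: differentiable_entry.
  - exact: esym (derive_coord u i j dz).
  - exact: esym (derive_coord v i j dz).
- exact: (differentiable_entry _ _ du).
- exact: (differentiable_entry _ _ dv).
Qed.

Lemma is_derive_entry (R : realType) (V : normedModType R) m n
    (f : V -> 'M[R]_(m, n)) x v df i j :
  is_derive x v f df -> is_derive x v (fun z => f z i j : R^o) (df i j).
Proof.
move=> [fx <-]; split; first exact: (derivable_mxP _ _ _).1 fx i j.
by rewrite derive_mx // mxE.
Qed.

Lemma is_derive_mulmx (R : realType) (V : normedModType R) m n p
    (f : V -> 'M[R]_(m, n)) (g : V -> 'M[R]_(n, p)) x v df dg :
  is_derive x v f df -> is_derive x v g dg ->
  is_derive x v (fun z => f z *m g z) (df *m g x + f x *m dg).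
Proof.
move=> [fx <-] [gx <-].
have E i j : is_derive x v (fun z => (f z *m g z) i j : R^o)
    (('D_v f x *m g x + f x *m 'D_v g x) i j).
  have -> : (fun z => (f z *m g z) i j : R^o) =
      \sum_k ((fun z => f z i k : R^o) * (fun z => g z k j : R^o)).
    by apply/funext => z; rewrite mxE fct_sumE.
  rewrite !mxE -big_split /=.
  apply: is_derive_sum => k.
  have fk := (derivable_mxP _ _ _).1 fx i k.
  have gk := (derivable_mxP _ _ _).1 gx k j.
  apply: is_derive_eq; first exact: is_deriveM (derivableP fk) (derivableP gk).
  by rewrite !derive_mx // !mxE addrC [g x k j *: _]mulrC.
have d : derivable (fun z => f z *m g z) x v.
  by apply/derivable_mxP => i j; have [] := E i j.
split => //; rewrite derive_mx //; apply/matrixP => i j; rewrite mxE.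
by have [] := E i j.
Qed.

Lemma derive_fst (R : realType) (V W : normedModType R) (f : R^o * V -> W) t y :
  'D_(1, 0) f (t, y) = 'D_1 (fun s : R^o => f (s, y)) t.
Proof.
rewrite /derive; set g := fun h => _; set g' := fun h => _.
suff -> : g = g' by [].
by apply/funext => h; rewrite /g /g' /=; congr (_ *: (f (_, _) - _));
  rewrite /= scaler0 add0r.
Qed.

Lemma derive_snd (R : realType) (V W : normedModType R) (f : R^o * V -> W) t y v :
  'D_(0, v) f (t, y) = 'D_v (fun z => f (t, z)) y.
Proof.
rewrite /derive; set g := fun h => _; set g' := fun h => _.
suff -> : g = g' by [].
by apply/funext => h; rewrite /g /g' /=; congr (_ *: (f (_, _) - _));
  rewrite /= scaler0 add0r.
Qed.

(** * The infinitesimal contact condition *)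

Lemma near_pair_slices (R : realType) (V : normedModType R) (t : R) (y : V)
    (P : R^o * V -> Prop) :
  (\forall z \near ((t : R^o), y), P z) ->
  (\forall s \near (t : R^o), P (s, y)) /\ (\forall x \near y, P (t, x)).
Proof.
move=> nP; split.
- exact: (@cvg_pair _ _ _ (nbhs (t : R^o)) (nbhs (t : R^o)) (nbhs y) _ _ _
    id (cst y) cvg_id (cvg_cst y) _ nP).
- exact: (@cvg_pair _ _ _ (nbhs y) (nbhs (t : R^o)) (nbhs y) _ _ _
    (cst (t : R^o)) id (cvg_cst _) cvg_id _ nP).
Qed.

(* Differentiates the identity of the last hypothesis at [t = 0]. *)
Lemma flow_infinitesimal (R : realType) (N : nat)
    (F : R^o * 'rV[R]_N -> 'rV[R]_N) (X : 'rV[R]_N -> 'rV[R]_N)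
    (e : 'rV[R]_N -> 'cV[R]_N) (y v : 'rV[R]_N) :
    (\forall z \near ((0 : R^o), y), differentiable F z) ->
    (forall w, differentiable ('D_w F) ((0 : R^o), y)) ->
    (\forall x \near y, F (0, x) = x) ->
    (\forall x \near y, 'D_1 (fun s : R^o => F (s, x)) 0 = X x) ->
    differentiable e y ->
    (\forall t \near (0 : R^o), 'D_v (fun x => F (t, x)) y *m e (F (t, y)) = 0) ->
  'D_v X y *m e y + v *m 'D_(X y) e y = 0.
Proof.
move=> dF d2F F0 XF de inv.
have F0y : F (0, y) = y := nbhs_singleton F0.
have dF0 : differentiable F ((0 : R^o), y) := nbhs_singleton dF.
have fstE (W' : normedModType R) (f : R^o * 'rV[R]_N -> W') :
    differentiable f ((0 : R^o), y) ->
    is_derive (0 : R^o) (1 : R^o) (fun s : R^o => f (s, y)) ('D_(1, 0) f (0, y)).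
  have E (s : R) : (s, y) = s *: ((1 : R^o), (0 : 'rV[R]_N)) + (0, y).
    by congr (_, _); rewrite /= ?scaler0 ?add0r // addr0 [RHS]mulr1.
  have -> : (fun s : R^o => f (s, y)) = (fun s => f (s *: (1, 0) + (0, y))).
    by apply/funext => s; rewrite -E.
  by rewrite [X in differentiable f X]E [X in 'D_(_, _) f X]E => /is_derive_line.
(* Exchanging the mixed partials, the time derivative of the spatial derivative of [F] at time 0 is
   the spatial derivative of the velocity [X]. *)
have d1 : is_derive (0 : R^o) (1 : R^o) (fun s : R^o => 'D_(0, v) F (s, y)) ('D_v X y).
  have -> : 'D_v X y = 'D_(1, 0) ('D_(0, v) F) (0, y).
    rewrite (derive_comm_mx dF) //.
    rewrite derive_snd; apply: near_eq_derive; apply: filterS XF => x <-.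
    by rewrite derive_fst.
  exact: fstE.
have d2 : is_derive (0 : R^o) (1 : R^o) (fun s : R^o => e (F (s, y))) ('D_(X y) e y).
  have dcomp : differentiable (e \o F) ((0 : R^o), y).
    by apply: differentiable_comp => //; rewrite F0y.
  have := fstE _ _ dcomp; rewrite (deriveE _ dcomp) diff_comp //; last by rewrite F0y.
  by rewrite /= -(deriveE _ dF0) derive_fst (nbhs_singleton XF) F0y -deriveE.
have := is_derive_mulmx d1 d2; rewrite F0y.
have -> : 'D_(0, v) F (0, y) = v.
  rewrite derive_snd (near_eq_derive v (_ : \forall x \near y, _ = id x)) //.
  exact: derive_id.
move=> [_ <-].
rewrite (near_eq_derive (1 : R^o) (_ : \forall s \near (0 : R^o), _ = cst 0 s)).
  exact: derive_cst.
by apply: filterS inv => t; rewrite derive_snd.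
Qed.

Lemma differentiable_is_derive (R : realType) (V W : normedModType R)
    (f : V -> W) x v : differentiable f x -> is_derive x v f ('D_v f x).
Proof. by move=> df; apply/derivableP/diff_derivable. Qed.

Lemma is_derive_trmx (R : realType) (V : normedModType R) m n
    (f : V -> 'M[R]_(m, n)) x v df :
  is_derive x v f df -> is_derive x v (fun z => (f z)^T) df^T.
Proof.
move=> [fx <-]; have d : derivable (fun z => (f z)^T) x v.
  apply/derivable_mxP => i j.
  have -> : (fun z => (f z)^T i j) = (fun z => f z j i).
    by apply/funext => z; rewrite mxE.
  exact: (derivable_mxP _ _ _).1 fx j i.
split => //; rewrite !derive_mx //; apply/matrixP => i j; rewrite !mxE.
by congr ('D_v _ x); apply/funext => z; rewrite mxE.
Qed.

(** * Consequences of the infinitesimal condition at a zero of the field *)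

Section ConformalDerivative.
Context (R : realType) (N : nat).
Variables (X : 'rV[R]_N -> 'rV[R]_N) (e : 'rV[R]_N -> 'cV[R]_N).
Variables (y r : 'rV[R]_N).
Hypothesis dX : \forall z \near y, differentiable X z.
Hypothesis d2X : forall w, differentiable ('D_w X) y.
Hypothesis de : \forall z \near y, differentiable e z.
Hypothesis d2e : forall w, differentiable ('D_w e) y.
Hypothesis Xy : X y = 0.
Hypothesis re : (r *m e y) 0 0 = 1.
Hypothesis inv : \forall z \near y, forall v : 'rV[R]_N, v *m e z = 0 ->
  'D_v X z *m e z + v *m 'D_(X z) e z = 0.

Let L := 'J X y.
Let tau := (r *m L *m e y) 0 0.

Let dXy : differentiable X y. Proof. exact: nbhs_singleton dX. Qed.
Let dey : differentiable e y. Proof. exact: nbhs_singleton de. Qed.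
Let DX (v : 'rV[R]_N) : 'D_v X y = v *m L. Proof. exact: deriveEjacobian. Qed.
Let rey : r *m e y = 1%:M. Proof. by rewrite [LHS]mx11_scalar re. Qed.

Let invy (v : 'rV[R]_N) : v *m e y = 0 -> v *m L *m e y = 0.
Proof.
by move=> ve; have := nbhs_singleton inv v ve; rewrite Xy derive0 mulmx0 addr0 DX.
Qed.

(** [L] preserves the kernel of [e y] by [invy]. Subtracting from a basis vector its component along
    [r] lands in that kernel, so [L *m e y] is determined by its value [tau] on [r]. *)
Lemma eigen_covector : L *m e y = tau *: e y.
Proof.
apply/row_matrixP => i; rewrite !rowE -scalemxAr.
set d := delta_mx 0 i; set c := (d *m e y) 0 0.
have cE : d *m e y = c%:M by rewrite [LHS]mx11_scalar.
have : (d - c *: r) *m e y = 0.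
  by rewrite mulmxBl -scalemxAl rey cE scale_scalar_mx mulr1 subrr.
move=> /invy; rewrite !mulmxBl -!scalemxAl => /eqP; rewrite subr_eq0 mulmxA => /eqP ->.
by rewrite cE [_ *m e y]mx11_scalar -/tau !scale_scalar_mx mulrC.
Qed.

(** The Lie derivative of the 1-form [e] along [X], evaluated on the constant vector [v]. *)
Let lie (v z : 'rV[R]_N) := 'D_v X z *m e z + v *m 'D_(X z) e z.

Let is_derive_lie (u v : 'rV[R]_N) :
  is_derive y u (lie v)
    ('D_u ('D_v X) y *m e y + v *m L *m 'D_u e y + v *m 'D_(u *m L) e y).
Proof.
(* The direction [X z] varies with [z]; writing the directional derivative as [A z *m (X z)^T] makes
   the product rule applicable, and the term differentiating [A] vanishes because [X y = 0]. *)
pose A z : 'M[R]_N := \matrix_(i, j) 'D_(delta_mx 0 j) e z i 0.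
have AE z w : differentiable e z -> 'D_w e z = A z *m w^T.
  move=> dez; apply/colP => i.
  rewrite [in LHS](row_sum_delta w) deriveE // linear_sum summxE mxE.
  by apply: eq_bigr => j _; rewrite linearZ /= -deriveE // !mxE mulrC.
have E : \forall z \near y, 'D_v X z *m e z + v *m (A z *m (X z)^T) = lie v z.
  by apply: filterS de => z dez; rewrite /lie AE.
apply: near_eq_is_derive E _.
have dA : derivable A y u.
  apply/derivable_mxP => i j.
  have -> : (fun z => A z i j) = (fun z => 'D_(delta_mx 0 j) e z i 0).
    by apply/funext => z; rewrite mxE.
  exact: (derivable_mxP _ _ _).1 (diff_derivable (d2e (delta_mx 0 j))) i 0.
have d1 := is_derive_mulmx (differentiable_is_derive u (d2X v))
  (differentiable_is_derive u dey).
have d2 := is_derive_mulmx (derivableP dA)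
  (is_derive_trmx (differentiable_is_derive u dXy)).
have d3 := is_derive_mulmx (is_derive_cst v y u) d2.
apply: (is_derive_eq (is_deriveD d1 d3)).
by rewrite -!DX Xy trmx0 !(mulmx0, mul0mx, add0r) -AE.
Qed.

(* For [v] in the kernel, [(r e) v - (v e) r] lies in the kernel at every
   point, so [lie v] and [tau (v e)] have the same derivative at [y]. *)
Let derive_lie (u v : 'rV[R]_N) : v *m e y = 0 ->
  'D_u (lie v) y = tau *: (v *m 'D_u e y).
Proof.
move=> ve.
have E : \forall z \near y, (r *m e z) *m lie v z = (v *m e z) *m lie r z.
  near=> z.
  have dXz : differentiable X z by near: z.
  have invz : forall v : 'rV[R]_N, v *m e z = 0 -> lie v z = 0 by near: z.
  rewrite [r *m e z]mx11_scalar [v *m e z]mx11_scalar !mul_scalar_mx.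
  set a := (r *m e z) 0 0; set b := (v *m e z) 0 0.
  have : (a *: v - b *: r) *m e z = 0.
    rewrite mulmxBl -!scalemxAl [r *m e z]mx11_scalar [v *m e z]mx11_scalar.
    by rewrite !scale_scalar_mx mulrC subrr.
  have dXl : 'D_(a *: v - b *: r) X z = a *: 'D_v X z - b *: 'D_r X z.
    rewrite !deriveE //. by rewrite linearB !linearZ.
  move=> /invz; rewrite /lie dXl !mulmxBl -!scalemxAl.
  by rewrite addrACA -opprD -!scalerDr => /eqP; rewrite subr_eq0 => /eqP.
have lie_v : lie v y = 0 := nbhs_singleton inv v ve.
have lie_r : lie r y = tau%:M.
  by rewrite /lie Xy derive0 mulmx0 addr0 DX [LHS]mx11_scalar.
have dme (w : 'rV[R]_N) : is_derive y u (fun z => w *m e z) (w *m 'D_u e y).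
  have := is_derive_mulmx (is_derive_cst w y u) (differentiable_is_derive u dey).
  by rewrite mul0mx add0r.
have dlie w := derivableP (@ex_derive _ _ _ _ _ _ _ (is_derive_lie u w)).
have [_ El] := is_derive_mulmx (dme r) (dlie v).
have [_ Er] := is_derive_mulmx (dme v) (dlie r).
(* At [y] the factors are [r e = 1], [v e = 0], [lie v = 0] and [lie r = tau], so one term of each
   product rule survives. *)
move: (near_eq_derive u E); rewrite El Er lie_v lie_r rey ve.
by rewrite mulmx0 add0r mul1mx mul0mx addr0 mul_mx_scalar.
Unshelve. all: by end_near.
Qed.

(** The exterior derivative of [e] at [y] on [u] and [v], with the sign convention of
    [ext_der_at]. *)
Let de2 (u v : 'rV[R]_N) := v *m 'D_u e y - u *m 'D_v e y.

(** The Lie derivative commutes with [d]: antisymmetrise [derive_lie] in [u] and [v]; the second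
    derivatives of [X] cancel by symmetry and the other terms regroup into [de2]. *)
Lemma conformal_ext_der (u v : 'rV[R]_N) : u *m e y = 0 -> v *m e y = 0 ->
  de2 (u *m L) v + de2 u (v *m L) = tau *: de2 u v.
Proof.
move=> ue ve.
have comm : 'D_u ('D_v X) y = 'D_v ('D_u X) y := derive_comm_mx dX (d2X v) (d2X u).
have aux (V : lmodType R) (a a' b c b' c' p q : V) : a = a' ->
    a + b + c = tau *: p -> a' + b' + c' = tau *: q ->
    c - b' + (b - c') = tau *: (p - q).
  move=> -> Eu Ev; rewrite scalerBr -Eu -Ev.
  have -> : a' + b + c - (a' + b' + c') = c + b - (b' + c').
    by rewrite -(addrA a' b) -(addrA a' b') opprD addrACA subrr add0r [b + c]addrC.
  by rewrite opprD addrACA.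
have [_ Eu] := is_derive_lie u v; have [_ Ev] := is_derive_lie v u.
apply: (aux _ _ _ _ _ _ _ _ _ (congr1 (mulmx^~ (e y)) comm)).
- exact: etrans (esym Eu) (derive_lie u ve).
- exact: etrans (esym Ev) (derive_lie v ue).
Qed.

End ConformalDerivative.

(** * Charts and flows *)

Lemma smooth_differentiable (R : realType) (V W : normedModType R) (U : set V)
    (f : V -> W) x : smooth U f -> U x -> differentiable f x.
Proof. by move=> sf Ux; have [df _] := sf 1%N; exact: df. Qed.

Lemma smooth_differentiable_derive (R : realType) (V W : normedModType R)
    (U : set V) (f : V -> W) x v :
  smooth U f -> U x -> differentiable ('D_v f) x.
Proof. by move=> sf Ux; have [_ df] := sf 2%N; have [ddf _] := df v; exact: ddf. Qed.

Lemma jacobian_comp (R : realType) (m n p : nat) (f : 'rV[R]_m -> 'rV[R]_n)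
    (g : 'rV[R]_n -> 'rV[R]_p) x :
  differentiable f x -> differentiable g (f x) ->
  'J (g \o f) x = 'J f x *m 'J g (f x).
Proof.
move=> df dg; apply/row_matrixP => i; rewrite !rowE mulmxA.
by rewrite /jacobian !mul_rV_lin1 diff_comp.
Qed.

Lemma jacobian_near_id (R : realType) (m : nat) (f : 'rV[R]_m -> 'rV[R]_m) x :
  differentiable f x -> (\forall z \near x, f z = z) -> 'J f x = 1%:M.
Proof.
move=> df fid; apply/row_matrixP => i; rewrite !rowE mulmx1.
rewrite -(deriveEjacobian _ df) (near_eq_derive _ (_ : \forall z \near x, _ = id z)) //.
exact: derive_id.
Qed.

Section Charts.
Context (R : realType) (N : nat) (M : manifold R N).
Implicit Types (c : chart R N M) (p q : M).

Lemma chart_img_nbhs c (O : set M) q :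
  nbhs q O -> cdom c q -> nbhs (c q) (c @` (O `&` cdom c)).
Proof.
move=> Oq cq.
have img : (c @` cdom c) (c q) by exists q.
have n1 : nbhs (c q) (c @` cdom c).
  by apply: open_nbhs_nbhs; split => //; exact: cimg_open.
have n2 : nbhs (c q) (cinv c @^-1` O).
  by apply: (cinv_continuous img); rewrite cmapK.
apply: filterS (filterI n1 n2) => z [[p cp <-]]; rewrite /preimage /= cmapK // => Op.
by exists p.
Qed.

Lemma chart_dom_nbhs c q : cdom c q -> nbhs q (cdom c).
Proof. by move=> cq; apply: open_nbhs_nbhs; split => //; exact: cdom_open. Qed.

Lemma transition_differentiable c c' q : atlas c -> atlas c' ->
  cdom c q -> cdom c' q -> differentiable (c' \o cinv c) (c q).
Proof.
move=> ac ac' cq c'q; apply: smooth_differentiable (atlas_compat ac ac') _.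
by exists q.
Qed.

Lemma transition_jacobian c c' q : atlas c -> atlas c' ->
  cdom c q -> cdom c' q ->
  'J (c' \o cinv c) (c q) *m 'J (c \o cinv c') (c' q) = 1%:M.
Proof.
move=> ac ac' cq c'q.
have E : (c' \o cinv c) (c q) = c' q by rewrite /= cmapK.
have d1 := transition_differentiable ac ac' cq c'q.
have d2 : differentiable (c \o cinv c') ((c' \o cinv c) (c q)).
  by rewrite E; exact: transition_differentiable.
rewrite -[X in _ *m 'J _ X]E -jacobian_comp // jacobian_near_id //.
  exact: differentiable_comp.
apply: filterS (chart_img_nbhs (chart_dom_nbhs c'q) cq) => _ [p [c'p cp] <-] /=.
by rewrite cmapK // cmapK.
Qed.

Lemma to_chartK c q : atlas c -> cdom c q -> to_chart c q *m of_chart c q = 1%:M.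
Proof.
move=> ac cq; apply: transition_jacobian => //;
  [exact: chart_at_atlas|exact: chart_at_dom].
Qed.

Lemma of_chart_self q : of_chart (chart_at q) q = 1%:M.
Proof.
have cq := chart_at_dom q; have ac := chart_at_atlas q.
apply: jacobian_near_id; first exact: transition_differentiable.
by apply: filterS (chart_img_nbhs (chart_dom_nbhs cq) cq) => _ [p [_ cp] <-] /=;
  rewrite cmapK.
Qed.

Lemma vf_in_chartE c (X : M -> 'rV[R]_N) q :
  cdom c q -> vf_in_chart c X (c q) = X q *m to_chart c q.
Proof. by move=> cq; rewrite /vf_in_chart cmapK. Qed.

Lemma oneform_in_chartE c (eta : M -> 'cV[R]_N) q :
  cdom c q -> oneform_in_chart c eta (c q) = of_chart c q *m eta q.
Proof. by move=> cq; rewrite /oneform_in_chart cmapK. Qed.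


Section Flow.
Variables (X : M -> 'rV[R]_N) (U : set M) (e : R) (Phi : R -> M -> M).
Hypotheses (openU : open U) (e_gt0 : 0 < e) (flow : local_flow X U e Phi).

Let flow_chart (c c' : chart R N M) (z : R^o * 'rV[R]_N) : 'rV[R]_N :=
  c' (Phi z.1 (cinv c z.2)).

Let flow0 q : U q -> Phi 0 q = q. Proof. by case: flow => + _ _ _; apply. Qed.

(** Joint continuity of the flow supplies the neighbourhoods on which its coordinate expressions are
    meaningful. *)
Lemma flow_chart_nbhs c q t (O : set M) : U q -> cdom c q -> `|t| < e ->
    nbhs (Phi t q) O ->
  \forall z \near ((t : R^o), c q), [/\ `|z.1| < e,
     (c @` (U `&` cdom c)) z.2 & O (Phi z.1 (cinv c z.2))].
Proof.
move=> Uq cq te nO; have [_ cont _ _] := flow.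
have cimg : (c @` cdom c) (c q) by exists q.
have C1 : \forall z \near ((t : R^o), c q), `|z.1| < e.
  have : \forall s \near (t : R^o), `|s| < e.
    apply: open_nbhs_nbhs; split => //.
    apply: (@open_comp _ _ (@Num.norm R R^o) [set x | x < e]); last exact: open_lt.
    by move=> ? _; exact: norm_continuous.
  exact: cvg_fst.
have C2 : \forall z \near ((t : R^o), c q), (c @` (U `&` cdom c)) z.2.
  have : \forall x \near c q, (c @` (U `&` cdom c)) x.
    by apply: chart_img_nbhs => //; exact: open_nbhs_nbhs.
  exact: cvg_snd.
have C3 : \forall z \near ((t : R^o), c q), O (Phi z.1 (cinv c z.2)).
  have h1 : (fun z : R^o * 'rV[R]_N => (z.1 : R)) @ ((t : R^o), c q) --> t.
    exact: cvg_fst.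
  have h2 : (fun z : R^o * 'rV[R]_N => cinv c z.2) @ ((t : R^o), c q) --> q.
    rewrite -[X in _ --> X](cmapK cq).
    have h : (fun z : R^o * 'rV[R]_N => z.2) @ ((t : R^o), c q) --> c q.
      exact: cvg_snd.
    exact: cvg_comp h (cinv_continuous cimg).
  have h3 : (fun z : R^o * 'rV[R]_N => ((z.1 : R), cinv c z.2)) @ ((t : R^o), c q)
      --> ((t : R), q) by exact: cvg_pair h1 h2.
  exact: cvg_comp h3 (cont t q te Uq) _ nO.
by apply: filterS (filterI C1 (filterI C2 C3)) => z [? [? ?]].
Qed.

Lemma flow_chart_dom_nbhs c c' q t : U q -> cdom c q -> `|t| < e ->
    cdom c' (Phi t q) ->
  \forall z \near ((t : R^o), c q), [/\ `|z.1| < e,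
     (c @` (U `&` cdom c)) z.2 & cdom c' (Phi z.1 (cinv c z.2))].
Proof. by move=> Uq cq te c'q; apply: flow_chart_nbhs => //; exact: chart_dom_nbhs. Qed.

Let flow_chart_smooth c c' : atlas c -> atlas c' ->
  smooth [set z : R^o * 'rV[R]_N | [/\ `|z.1| < e,
     (c @` (U `&` cdom c)) z.2 & cdom c' (Phi z.1 (cinv c z.2))]] (flow_chart c c').
Proof. by move=> ac ac'; case: flow => _ _ + _; apply. Qed.

Let flow_chart_slice_differentiable c c' q t : atlas c -> atlas c' ->
    U q -> cdom c q -> `|t| < e -> cdom c' (Phi t q) ->
  differentiable (fun x => flow_chart c c' (t, x)) (c q).
Proof.
move=> ac ac' Uq cq te c'q.
have dF : differentiable (flow_chart c c') ((t : R^o), c q).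
  apply: smooth_differentiable (flow_chart_smooth ac ac') _.
  exact: nbhs_singleton (flow_chart_dom_nbhs Uq cq te c'q).
apply: (@differentiable_comp _ _ _ _ (fun x => ((t : R^o), x))
  (flow_chart c c')) => //.
Qed.

(** [tangent_map] is read in the charts selected at [q] and at [Phi t q], so the chain rule adds a
    change of coordinates from [c] before it and one back to [c] after it. *)
Lemma derive_flow_space c q t v : atlas c -> U q -> cdom c q -> `|t| < e ->
    cdom c (Phi t q) ->
  'D_v (fun x => c (Phi t (cinv c x))) (c q) =
  v *m of_chart c q *m tangent_map (Phi t) q *m to_chart c (Phi t q).
Proof.
move=> ac Uq cq te cq'; set q' := Phi t q in cq' *.
pose b := chart_at q; pose b' := chart_at q'.
have ab : atlas b := chart_at_atlas q; have bq : cdom b q := chart_at_dom q.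
have ab' : atlas b' := chart_at_atlas q'; have bq' : cdom b' q' := chart_at_dom q'.
pose G x := b' (Phi t (cinv b x)).
have dG : differentiable G (b q) by exact: flow_chart_slice_differentiable.
have Eb : (b \o cinv c) (c q) = b q by rewrite /= cmapK.
have EG : (G \o (b \o cinv c)) (c q) = b' q' by rewrite /G /= cmapK // cmapK.
have d1 : differentiable (b \o cinv c) (c q) by exact: transition_differentiable.
have d2 : differentiable (G \o (b \o cinv c)) (c q).
  by apply: differentiable_comp => //; rewrite Eb.
have d3 : differentiable (c \o cinv b') ((G \o (b \o cinv c)) (c q)).
  by rewrite EG; exact: transition_differentiable.
have E : \forall x \near c q,
    c (Phi t (cinv c x)) = ((c \o cinv b') \o (G \o (b \o cinv c))) x.
  have [_ n1] := near_pair_slices (flow_chart_dom_nbhs Uq cq te bq').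
  have n2 := chart_img_nbhs (chart_dom_nbhs bq) cq.
  apply: filterS (filterI n1 n2) => x [[_ _ b'x] [p [bp cp] xE]].
  by move: b'x; rewrite -xE /G /= (cmapK cp) (cmapK bp) => b'p; rewrite cmapK.
rewrite (near_eq_derive v E) deriveEjacobian; last exact: differentiable_comp.
rewrite jacobian_comp // jacobian_comp ?Eb // EG !mulmxA.
by [].
Qed.

(** The velocity is given in the chart selected at [Phi 0 q = q]; the transition to [c] produces the
    factor [to_chart]. *)
Lemma derive_flow_time c q : atlas c -> U q -> cdom c q ->
  'D_1 (fun s : R^o => c (Phi s q)) 0 = vf_in_chart c X (c q).
Proof.
move=> ac Uq cq; have [_ _ _ vel] := flow.
have e0 : `|0 : R| < e by rewrite normr0.
pose b := chart_at q.
have ab : atlas b := chart_at_atlas q; have bq : cdom b q := chart_at_dom q.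
have := vel 0 q e0 Uq; rewrite flow0 // -/b => -[vd vE].
have dg : differentiable (fun s : R^o => b (Phi s q)) 0.
  exact/derivable1_diffP.
have Eb0 : b (Phi 0 q) = b q by rewrite flow0.
have dc : differentiable (c \o cinv b) (b (Phi 0 q)).
  by rewrite Eb0; exact: transition_differentiable.
have E : \forall s \near (0 : R^o),
    c (Phi s q) = ((c \o cinv b) \o (fun s : R^o => b (Phi s q))) s.
  have bq0 : cdom b (Phi 0 q) by rewrite flow0.
  have [n1 _] := near_pair_slices (flow_chart_dom_nbhs Uq bq e0 bq0).
  by apply: filterS n1 => s [_ _ /=]; rewrite cmapK // => bs; rewrite cmapK.
rewrite (near_eq_derive _ E) deriveE; last exact: differentiable_comp.
rewrite (diff_comp dg dc) [LHS]/=.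
have <- : X q = 'd (fun s : R^o => b (Phi s q)) 0 (1 : R^o).
  by rewrite -(deriveE _ dg).
rewrite -(deriveE _ dc) (deriveEjacobian _ dc).
by rewrite Eb0 vf_in_chartE.
Qed.

End Flow.
End Charts.

(** * Linear part of a contact vector field *)

(** For small [t] the point [Phi t q] stays in [W], and the tangent map carries a vector of [xi q]
    into [xi (Phi t q)], the kernel of [eta] there. This is the identity that [flow_infinitesimal]
    differentiates. *)
Lemma flow_preserves_infinitesimal (R : realType) (N : nat) (M : manifold R N)
    (xi : M -> 'M[R]_N) (X : M -> 'rV[R]_N) (W : set M)
    (eta : M -> 'cV[R]_N) (U : set M) (t0 : R) (Phi : R -> M -> M)
    (c : chart R N M) (q : M) :
    atlas c -> open W -> smooth_oneform W eta ->
    (forall p, W p -> (kermx (eta p) == xi p)%MS) ->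
    open U -> 0 < t0 -> local_flow X U t0 Phi -> flow_preserves xi U t0 Phi ->
    W q -> U q -> cdom c q ->
  forall v : 'rV[R]_N, v *m oneform_in_chart c eta (c q) = 0 ->
    'D_v (vf_in_chart c X) (c q) *m oneform_in_chart c eta (c q) +
    v *m 'D_(vf_in_chart c X (c q)) (oneform_in_chart c eta) (c q) = 0.
Proof.
move=> ac oW seta kerW oU t00 flow pres Wq Uq cq v veta.
have cancel (P Q : 'M[R]_N) (a : 'rV[R]_N) (b : 'cV[R]_N) :
    P *m Q = 1%:M -> a *m P *m (Q *m b) = a *m b.
  by move=> PQ; rewrite mulmxA -(mulmxA a) PQ mulmx1.
have [flow0 _ fsmooth _] := flow.
have t0e : `|0 : R| < t0 by rewrite normr0.
pose F (z : R^o * 'rV[R]_N) : 'rV[R]_N := c (Phi z.1 (cinv c z.2)).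
have c0q : cdom c (Phi 0 q) by rewrite flow0.
have nF := flow_chart_dom_nbhs oU flow Uq cq t0e c0q.
have nU : \forall x \near c q, (c @` (U `&` cdom c)) x.
  by apply: chart_img_nbhs => //; apply: open_nbhs_nbhs.
apply: (@flow_infinitesimal _ _ F).
- apply: filterS nF => z; exact: smooth_differentiable (fsmooth c c ac ac).
- move=> w; apply: smooth_differentiable_derive (fsmooth c c ac ac) _.
  exact: nbhs_singleton nF.
- by apply: filterS nU => _ [p [Up cp] <-]; rewrite /F /= cmapK // flow0.
- apply: filterS nU => _ [p [Up cp] <-]; rewrite /F /= cmapK //.
  exact: (derive_flow_time oU t00 flow).
- by apply: smooth_differentiable (seta c ac) _; exists q.
- have nW : nbhs (Phi 0 q) (W `&` cdom c).
    rewrite flow0 //; apply: filterI; last exact: chart_dom_nbhs.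
    exact: open_nbhs_nbhs.
  have [n1 _] := near_pair_slices (flow_chart_nbhs oU flow Uq cq t0e nW).
  apply: filterS n1 => t [/= te _]; rewrite cmapK // => -[Wq' cq'].
  rewrite /F /= cmapK // (derive_flow_space oU flow) // oneform_in_chartE //.
  rewrite (cancel _ _ _ _ (to_chartK ac cq')).
  apply/sub_kermxP; rewrite (eqmxP (kerW _ Wq')) -(eqmxP (pres _ _ te Uq)).
  apply: submxMr; rewrite -(eqmxP (kerW _ Wq)); apply/sub_kermxP.
  by rewrite -mulmxA -oneform_in_chartE.
Qed.

(** The whole space is the sum of [V] and the line of [r], and [r] pairs to zero with everything. A
    vector of [V] that pairs to zero with [V] therefore pairs to zero with all vectors. *)
Lemma restrict_form_unitmx (F : fieldType) (N : nat) (V Om : 'M[F]_N)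
    (e : 'cV[F]_N) (r : 'rV[F]_N) :
    (kermx e == V)%MS -> r *m e = 1%:M -> Om *m r^T = 0 ->
    (forall u : 'rV[F]_N, u *m e = 0 -> u *m Om = 0 -> u = 0) ->
  row_base V *m Om *m (row_base V)^T \in unitmx.
Proof.
move=> kV re Omr nondeg; set B := row_base V.
have BE : (B :=: V)%MS := eq_row_base V.
have Bfree : row_free B := row_base_free V.
have Beta : B *m e = 0 by apply/sub_kermxP; rewrite (eqmxP kV) BE.
have kB : (kermx e <= B)%MS by rewrite (eqmxP kV) BE.
move: (\rank V) B {BE} Bfree Beta kB => m B Bfree Beta kB.
rewrite -row_free_unit -kermx_eq0; apply/eqP/row_matrixP => i; rewrite row0.
set w := row i _.
have wk : w *m (B *m Om *m B^T) = 0 by rewrite /w -row_mul mulmx_ker row0.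
suff : w *m B = 0 by move=> /eqP; rewrite mulmx_free_eq0 // => /eqP.
apply: nondeg; first by rewrite -mulmxA Beta mulmx0.
set u := w *m B *m Om.
have uB : u *m B^T = 0 by rewrite /u -wk !mulmxA.
have ur : u *m r^T = 0 by rewrite /u -mulmxA Omr mulmx0.
(* [1%:M - e *m r] is the projection onto the kernel of [e] along [r], so its rows are combinations
   of the rows of [B]. *)
have [C CE] : exists C, 1%:M - e *m r = C *m B.
  apply/submxP; apply: submx_trans kB; apply/sub_kermxP.
  by rewrite mulmxBl mul1mx -mulmxA re mulmx1 subrr.
have : u *m (1%:M - e *m r)^T = 0 by rewrite CE trmx_mul mulmxA uB mul0mx.
by rewrite linearB /= trmx1 trmx_mul mulmxBr mulmx1 mulmxA ur mul0mx subr0.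
Qed.

(** The matrix is [E - E^T], where row [i] of [E] is the transposed [i]-th partial derivative of the
    coordinate covector. The equality between functions permits rewriting under [wedge_pow]. *)
Lemma ext_der_atE (R : realType) (N : nat) (M : manifold R N)
    (eta : M -> 'cV[R]_N) (p : M) :
  differentiable (oneform_in_chart (chart_at p) eta) (chart_at p p) ->
  exists2 Om : 'M[R]_N, Om^T = - Om &
    (forall u v : 'rV[R]_N, u *m Om *m v^T =
      v *m 'D_u (oneform_in_chart (chart_at p) eta) (chart_at p p) -
      u *m 'D_v (oneform_in_chart (chart_at p) eta) (chart_at p p)) /\
    ext_der_at eta p =
    (fun A : 'M[R]_(1 + 1, N) => (usubmx A *m Om *m (dsubmx A)^T) 0 0).
Proof.
set ec := oneform_in_chart _ _; set y := chart_at p p => de.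
pose E := \matrix_i ('D_(delta_mx 0 i) ec y)^T.
have DE (u : 'rV[R]_N) : 'D_u ec y = (u *m E)^T.
  rewrite (deriveE _ de) [in LHS](row_sum_delta u) linear_sum mulmx_sum_row.
  rewrite linear_sum /=; apply: eq_bigr => j _.
  by rewrite rowK !linearZ /= trmxK (deriveE _ de).
have OmE u v : u *m (E - E^T) *m v^T = v *m 'D_u ec y - u *m 'D_v ec y.
  have tr1 (a : 'M[R]_1) : a^T = a by rewrite [a]mx11_scalar tr_scalar_mx.
  rewrite !DE mulmxBr mulmxBl -[X in _ = X - _]tr1 (trmx_mul v) trmxK.
  by rewrite (trmx_mul v) mulmxA.
exists (E - E^T); first by rewrite linearB /= trmxK opprB.
have subE (a b : 'M[R]_1) : (a - b) 0 0 = a 0 0 - b 0 0 by rewrite !mxE.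
by split=> //; apply/funext => A; rewrite OmE; exact: esym (subE _ _).
Qed.

Lemma count_mem_involutive (T : eqType) (s : seq T) (f : T -> T) z :
  involutive f -> perm_eq s [seq f x | x <- s] -> count_mem (f z) s = count_mem z s.
Proof.
move=> fK /seq.permP ->; rewrite count_map; apply: eq_count => x /=.
by rewrite (inj_eq (can_inj fK)).
Qed.

Theorem corollary2p5 (R : realType) (n : nat) (M : manifold R (n * 2).+1)
    (xi : M -> 'M[R]_((n * 2).+1)) (hxi : contact_structure xi)
    (X : M -> 'rV[R]_((n * 2).+1)) (hX : contact_vector_field xi X)
    (W : set M) (eta : M -> 'cV[R]_((n * 2).+1)) (heta : local_form xi W eta)
    (Rb : M -> 'rV[R]_((n * 2).+1)) (hRb : is_reeb W eta Rb)
    (x0 : M) (hWx0 : W x0) (hx0 : X x0 = 0) :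
  let tau := principal_coefficient eta Rb X x0 in
  let L := linear_part X x0 in
  let Lxi := restrictmx (xi x0) L in
  let half_tau : R[i] := (tau / 2)%:C in
  [/\ eta x0 != 0,
      L *m eta x0 = tau *: eta x0,
      stablemx (xi x0) L &
      exists s : seq R[i],
        [/\ size s = (n * 2)%N,
            is_spectrum L (tau%:C :: s),
            is_spectrum Lxi s &
            forall lam : R[i], half_tau + lam \in s ->
              forall z : R[i],
                z \in [:: half_tau - lam; half_tau + lam^*; half_tau - lam^*] ->
                z \in s /\
                count_mem z s = count_mem (half_tau + lam) s]].
Proof.
move=> tau L Lxi half_tau.
have [oW seta kerW] := heta.
have [sX hflow] := hX.
have [reta reeb] := hRb _ hWx0.
have kV := kerW _ hWx0.
(* All computations use the chart selected at [x0], whose coordinate change at [x0] is the identity,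
   so that [ec y] equals [eta x0]. *)
set c := chart_at x0; have ac : atlas c := chart_at_atlas x0.
have cx0 : cdom c x0 := chart_at_dom x0.
set y := c x0.
set ec := oneform_in_chart c eta; set Xc := vf_in_chart c X.
have ecy : ec y = eta x0.
  by rewrite /ec /y oneform_in_chartE // of_chart_self mul1mx.
have Xcy : Xc y = 0 by rewrite /Xc /y vf_in_chartE // hx0 mul0mx.
have nX : \forall z \near y, (c @` (setT `&` cdom c)) z.
  by apply: chart_img_nbhs => //; exact: filterT.
have nW : \forall z \near y, (c @` (W `&` cdom c)) z.
  by apply: chart_img_nbhs => //; exact: open_nbhs_nbhs.
have dX : \forall z \near y, differentiable Xc z.
  by apply: filterS nX => z; exact: smooth_differentiable (sX c ac).
have d2X w : differentiable ('D_w Xc) y.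
  exact: smooth_differentiable_derive (sX c ac) (nbhs_singleton nX).
have de : \forall z \near y, differentiable ec z.
  by apply: filterS nW => z; exact: smooth_differentiable (seta c ac).
have d2e w : differentiable ('D_w ec) y.
  exact: smooth_differentiable_derive (seta c ac) (nbhs_singleton nW).
have inv : \forall z \near y, forall v : 'rV[R]_(n * 2).+1, v *m ec z = 0 ->
    'D_v Xc z *m ec z + v *m 'D_(Xc z) ec z = 0.
  have [U [t0 [Phi [oU Ux0 t00 flow pres]]]] := hflow x0.
  have nUW : \forall z \near y, (c @` ((W `&` U) `&` cdom c)) z.
    by apply: chart_img_nbhs => //; apply: filterI; exact: open_nbhs_nbhs.
  apply: filterS nUW => _ [q [[Wq Uq] cq] <-].
  exact: (flow_preserves_infinitesimal ac oW seta kerW oU t00 flow pres).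
set r := Rb x0 in reta reeb *.
have rec : (r *m ec y) 0 0 = 1 by rewrite ecy.
have LE : L = 'J Xc y by [].
(* The signs in [tau] and in the Hamiltonian cancel; in the product rule the term differentiating
   [ec] carries the factor [Xc y = 0]. *)
have tauE : tau = (r *m L *m ec y) 0 0.
  have near_ham : \forall z \near y,
      (hamiltonian eta X \o cinv c : _ -> R^o) z = - (Xc z *m ec z) 0 0.
    apply: filterS nW => _ [q [_ cq] <-] /=.
    rewrite /hamiltonian /Xc /ec vf_in_chartE // oneform_in_chartE // cmapK //.
    by rewrite mulmxA -(mulmxA (X q)) to_chartK // mulmx1.
  have dXr : is_derive y r Xc (r *m L).
    apply: is_derive_eq (differentiable_is_derive r (nbhs_singleton dX)) _.
    exact: deriveEjacobian (nbhs_singleton dX).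
  have dXe := is_derive_entry 0 0 (is_derive_mulmx dXr
    (differentiable_is_derive r (nbhs_singleton de))).
  have [_ E] := is_deriveN dXe.
  rewrite /tau /principal_coefficient /dir_der (near_eq_derive r near_ham).
  apply: etrans (congr1 -%R E) _.
  by rewrite opprK Xcy mul0mx addr0.
have Leta : L *m eta x0 = tau *: eta x0.
  have := eigen_covector dX Xcy rec inv.
  by rewrite -LE -tauE ecy.
have [Om OmT [OmE extE]] := @ext_der_atE _ _ M eta x0 (nbhs_singleton de).
(* The Reeb condition, tested on basis vectors, gives [r *m Om = 0]; antisymmetry of [Om] moves [r]
   to the other side. *)
have Omr : Om *m r^T = 0.
  apply: trmx_inj; rewrite trmx_mul trmxK OmT trmx0 mulmxN.
  apply/eqP; rewrite oppr_eq0; apply/eqP/rowP => j; rewrite [RHS]mxE.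
  have := reeb (delta_mx 0 j); rewrite extE col_mxKu col_mxKd trmx_delta.
  by rewrite -colE mxE.
have conf (u v : 'rV[R]_(n * 2).+1) : u *m eta x0 = 0 -> v *m eta x0 = 0 ->
    u *m L *m Om *m v^T + u *m Om *m (v *m L)^T = tau *: (u *m Om *m v^T).
  rewrite -ecy => ue ve; rewrite !OmE.
  have := conformal_ext_der dX d2X de d2e Xcy rec inv ue ve.
  by rewrite -tauE.
have rE : r *m eta x0 = 1%:M by rewrite [LHS]mx11_scalar reta.
have eta0 : eta x0 != 0.
  by apply/eqP => e0; move: reta; rewrite e0 mulmx0 mxE => /esym/eqP;
    rewrite oner_eq0.
have nondeg (u : 'rV[R]_(n * 2).+1) : u *m eta x0 = 0 -> u *m Om = 0 -> u = 0.
  move=> ue uO; have [_ /(_ W eta heta x0 hWx0) [A]] := hxi.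
  rewrite extE => wA; apply: (wedge_contact_nondegenerate wA ue uO).
  by apply: trmx_inj; rewrite trmx_mul trmxK OmT mulmxN uO oppr0 trmx0.
have xie : xi x0 *m eta x0 = 0 by apply/sub_kermxP; rewrite (eqmxP kV).
have stab : stablemx (xi x0) L.
  rewrite -(eqmxP kV); apply/sub_kermxP.
  by rewrite -mulmxA Leta -scalemxAr xie scaler0.
split => //.
set B := row_base (xi x0).
have Beta : B *m eta x0 = 0 by apply/sub_kermxP; rewrite (eqmxP kV) eq_row_base.
have Ou : B *m Om *m B^T \in unitmx := restrict_form_unitmx kV rE Omr nondeg.
have BL : Lxi *m B = B *m L.
  by rewrite /Lxi /conjmx mulmxKpV // stablemx_row_base.
clearbody B.
(* Entry [(i, j)] is [conf] applied to rows [i] and [j] of [B], which lie in the kernel of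
   [eta x0]. *)
have AOm : Lxi *m (B *m Om *m B^T) + (B *m Om *m B^T) *m Lxi^T
    = tau *: (B *m Om *m B^T).
  have entryE m (P Q : 'M[R]_(m, (n * 2).+1)) i j :
      (P *m Om *m Q^T) i j = (row i P *m Om *m (row j Q)^T) 0 0.
    by rewrite -row_mul !mxE; apply: eq_bigr => k _; rewrite !mxE.
  have -> : Lxi *m (B *m Om *m B^T) = B *m L *m Om *m B^T by rewrite !mulmxA BL.
  have -> : B *m Om *m B^T *m Lxi^T = B *m Om *m (B *m L)^T.
    by rewrite -BL (trmx_mul Lxi) !mulmxA.
  have rowB i : row i B *m eta x0 = 0 by rewrite -row_mul Beta row0.
  apply/matrixP => i j; rewrite mxE [RHS]mxE.
  rewrite (entryE _ (B *m L) B) (entryE _ B (B *m L)) (entryE _ B B).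
  rewrite (row_mul i B) (row_mul j B).
  have /matrixP/(_ 0 0) := conf _ _ (rowB i) (rowB j).
  by rewrite mxE => ->; rewrite mxE.
have [s [ssz sspec sneg sconj]] := conformal_spectrum Ou AOm.
exists s; split => //.
- rewrite ssz; have [+ _] := hxi; by case=> /(_ x0).
- rewrite /is_spectrum -map_char_poly (char_poly_restrict_hyperplane kV reta Leta).
  by rewrite rmorphM rmorphB /= map_polyX map_polyC /= map_char_poly sspec big_cons.
move=> lam lams z; rewrite !inE.
have negK : involutive (fun z : R[i] => tau%:C - z) by move=> x; rewrite subKr.
have conjK : involutive (@conjc R) := @conjcK R.
(* Since [half_tau] is real and doubles to [tau], the map [w |-> tau - w] sends [half_tau + lam] to
   [half_tau - lam], conjugation sends it to [half_tau + lam^*], and their composite gives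
   [half_tau - lam^*]. *)
have half2 : tau%:C = half_tau + half_tau.
  by rewrite -rmorphD -splitr.
have halfc : (half_tau^* = half_tau)%C by exact: conjc_real.
have E1 : half_tau - lam = tau%:C - (half_tau + lam).
  by rewrite half2; ring.
(* Membership follows from the multiplicity, which is positive because [half_tau + lam] is in
   [s]. *)
have cntE w : count_mem w s = count_mem (half_tau + lam) s ->
    w \in s /\ count_mem w s = count_mem (half_tau + lam) s.
  by move=> wE; split => //; rewrite -has_pred1 has_count wE -has_count has_pred1.
have cneg w : count_mem (tau%:C - w) s = count_mem w s :=
  count_mem_involutive w negK sneg.
have cconj w : count_mem (w^*)%C s = count_mem w s :=
  count_mem_involutive w conjK sconj.
move=> /or3P[] /eqP ->; apply: cntE.
- by rewrite E1 cneg.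
- by rewrite -{1}halfc -rmorphD cconj.
- by rewrite -{1}halfc -rmorphB cconj E1 cneg.
Qed.
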